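(* Let $\Omega=\Omega_e\cup\Omega_o\subset\mathbb{Z}_2^n\setminus\{\mathbf 0\}$, where $\Omega_e$ and $\Omega_o$ are both nonempty, every tuple in $\Omega_e$ has even Hamming weight and every tuple in $\Omega_o$ has odd Hamming weight, and suppose $r(\Omega)=n$. Let $k=\min_{\beta\in\Omega_e}s(\beta)$, $l=\min_{\beta\in\Omega_o}s(\beta)$, $\Omega_e^*=\{\beta\in\Omega_e: s(\beta)=k\}$ and $\Omega_o^*=\{\beta\in\Omega_o:s(\beta)=l\}$. If either $\sum_{\beta\in\Omega_o^*}\beta\neq\mathbf 0$ in $\mathbb{Z}_2^n$ or $\sum_{\beta\in\Omega_e^*}\beta\neq\mathbf 0$ in $\mathbb{Z}_2^n$, then $\mathrm{NEPS}(P_3,\ldots,P_3;\Omega)$ exhibits pretty good state transfer between some pair of distinct vertices.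
   Context: $P_3$ is the path on three vertices. For graphs $G_1,\dots,G_n$ and $\Omega\subset\mathbb{Z}_2^n\setminus\{\mathbf 0\}$, $\mathrm{NEPS}(G_1,\dots,G_n;\Omega)$ is the graph on $V(G_1)\times\cdots\times V(G_n)$ in which $(x_1,\dots,x_n)$ and $(y_1,\dots,y_n)$ are adjacent iff there is $\beta\in\Omega$ with $x_i=y_i$ whenever $\beta_i=0$ and $x_i$ adjacent to $y_i$ in $G_i$ whenever $\beta_i=1$; its adjacency matrix is $\sum_{\beta\in\Omega}A_1^{\beta_1}\otimes\cdots\otimes A_n^{\beta_n}$. The Hamming weight $s(\beta)$ is the number of entries of $\beta$ equal to $1$. $r(\Omega)$ denotes the rank over $\mathbb{Z}_2$ of the matrix whose rows are the elements of $\Omega$. The transition matrix of a graph with adjacency matrix $A$ is $H(t)=\exp(-itA)$. A graph has pretty good state transfer (PGST) from vertex $u$ to vertex $v$ if for every $\epsilon>0$ there is $t\in\mathbb R$ with $\big||e_u^TH(t)e_v|-1\big|<\epsilon$. *)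

(* Defs.v *)
From Stdlib Require Import Reals.
From HB Require Import structures.
From mathcomp Require Import all_boot all_order all_algebra.
Set Implicit Arguments. Unset Strict Implicit. Unset Printing Implicit Defensive.
Import GRing.Theory.
Local Open Scope ring_scope.

Definition Z2vec (n : nat) := 'rV['F_2]_n.

Definition hweight (n : nat) (b : Z2vec n) : nat :=
  #|[set i : 'I_n | b ord0 i != 0%R]|.

Definition Omega_e (n : nat) (Om : {set Z2vec n}) : {set Z2vec n} :=
  [set b in Om | ~~ odd (hweight b)].
Definition Omega_o (n : nat) (Om : {set Z2vec n}) : {set Z2vec n} :=
  [set b in Om | odd (hweight b)].

Definition min_weight_part (n : nat) (S : {set Z2vec n}) : {set Z2vec n} :=
  [set b in S | [forall c in S, (hweight b <= hweight c)%N]].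

Definition rankZ2 (n : nat) (Om : {set Z2vec n}) : nat :=
  \rank (\matrix_(i < #|Om|, j < n) (enum_val i : Z2vec n) ord0 j).

Definition P3adj (a b : 'I_3) : bool := ((a : nat).+1 == b) || ((b : nat).+1 == a).

Definition vert (n : nat) := {ffun 'I_n -> 'I_3}.

Definition neps_adj (n : nat) (Om : {set Z2vec n}) (x y : vert n) : bool :=
  [exists b in Om, [forall i : 'I_n,
     if b ord0 i == 0%R then x i == y i else P3adj (x i) (y i)]].

Fixpoint adj_pow (n : nat) (Om : {set Z2vec n}) (m : nat) (x y : vert n) : nat :=
  match m with
  | 0 => (x == y : nat)
  | m'.+1 => \sum_(w : vert n) ((neps_adj Om x w : nat) * adj_pow Om m' w y)%N
  end.

Local Close Scope ring_scope.
Local Open Scope R_scope.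

(* real and imaginary parts of (-i)^m *)
Definition re_negi (m : nat) : R :=
  match (m %% 4)%N with 0%N => 1 | 2%N => -1 | _ => 0 end.
Definition im_negi (m : nat) : R :=
  match (m %% 4)%N with 1%N => -1 | 3%N => 1 | _ => 0 end.

(* m-th term of the series sum_m (-i t)^m / m! (A^m)_{x y}, split into Re / Im *)
Definition H_term_re (n : nat) (Om : {set Z2vec n}) (t : R) (x y : vert n) (m : nat) : R :=
  re_negi m * (t ^ m / INR (Factorial.fact m)) * INR (adj_pow Om m x y).
Definition H_term_im (n : nat) (Om : {set Z2vec n}) (t : R) (x y : vert n) (m : nat) : R :=
  im_negi m * (t ^ m / INR (Factorial.fact m)) * INR (adj_pow Om m x y).

Definition PGST (n : nat) (Om : {set Z2vec n}) (u v : vert n) : Prop :=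
  forall eps : R, 0 < eps ->
    exists t a b : R,
      infinite_sum (H_term_re Om t u v) a /\
      infinite_sum (H_term_im Om t u v) b /\
      Rabs (sqrt (a * a + b * b) - 1) < eps.

(* Main.v *)
Require Import Defs.
From Stdlib Require Import Reals.
From HB Require Import structures.
From mathcomp Require Import all_boot all_order all_algebra.
From mathcomp Require Import ring lra zify Rstruct.
(** The eigenvectors of NEPS(P_3, ..., P_3; Om) are tensor products of those
    of P_3, with eigenvalues [\sum_(b in Om) sqrt 2 ^ s(b) * z_b], where [z_b]
    is the product over the support of [b] of signs in {1, 0, -1}.
    Let [j] be a coordinate at which the sum of the minimal weight tuples of
    one parity class (of weight [m], say) is nonzero.  Take [u] and [v] equal
    to the middle vertex of P_3 in every coordinate but [j], where they are the
    two end vertices.  An eigenvector that does not vanish at [u] has all signs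
    nonzero off [j], and its values at [u] and [v] agree up to a sign that is
    -1 exactly when the sign at [j] is 0.
    Iterated squaring of the unit 3 - 2 sqrt 2 gives integers with
    [P - 2 ^ (m + 1) * Q * sqrt 2] tending to 0 and [P] odd.  At time
    [2 PI Q sqrt 2 ^ (m + 1)] the tuples of the other parity contribute
    multiples of [2 PI] to the phase, and those of the parity of [m] contribute
    [PI c] up to a small error, with [c] congruent mod 2 to the number of
    weight [m] tuples with [z_b] nonzero.  By the choice of [j] this parity
    depends on the sign at [j] exactly as the sign relating [u] and [v]. *)

Set Implicit Arguments. Unset Strict Implicit. Unset Printing Implicit Defensive.
Import Order.TTheory GRing.Theory Num.Theory.
Local Open Scope ring_scope.

(* The R_scope argument scopes would otherwise shadow the ring operations. *)
Local Arguments infinite_sum s l : clear scopes.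
Local Arguments Un_cv Un l : clear scopes.
Local Arguments cos x : clear scopes.
Local Arguments sin x : clear scopes.
Local Arguments sqrt x : clear scopes.

(** * Spectral decomposition of the adjacency matrix of NEPS(P_3, ..., P_3; Om) *)

Section Spectral.

Variables (F : fieldType) (q : F).
Hypotheses (q_sqr : q * q = 2) (q_neq0 : q != 0).

(** The argument labels an eigenvector of P_3, whose eigenvalue is [q] times this integer. *)
Definition P3sgn (l : 'I_3) : int :=
  match val l with 0 => 1 | 1 => 0 | _ => - 1 end.

(** An orthonormal eigenbasis of P_3, with [q] standing for sqrt 2. *)
Definition P3vec (l x : 'I_3) : F :=
  match val l, val x with
  | 1%N, 0%N => q^-1
  | 1%N, 1%N => 0
  | 1%N, _ => - q^-1
  | _, 1%N => (P3sgn l)%:~R * q / 2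
  | _, _ => 1 / 2
  end.

Lemma P3vec_complete (x y : 'I_3) :
  \sum_(l : 'I_3) P3vec l x * P3vec l y = (x == y)%:R.
Proof.
have two_neq0 : 2 != 0 :> F by rewrite -q_sqr mulf_neq0.
rewrite !big_ord_recl big_ord0.
case: x => [[|[|[|//]]] ?]; case: y => [[|[|[|//]]] ?];
  rewrite /P3vec /P3sgn -?(inj_eq val_inj) /=; field: q_sqr; rewrite ?two_neq0 ?q_neq0 //.
Qed.

Lemma P3vec_eigen (l x : 'I_3) :
  \sum_(y : 'I_3) (P3adj x y)%:R * P3vec l y = q * (P3sgn l)%:~R * P3vec l x.
Proof.
have two_neq0 : 2 != 0 :> F by rewrite -q_sqr mulf_neq0.
rewrite !big_ord_recl big_ord0.
case: x => [[|[|[|//]]] ?]; case: l => [[|[|[|//]]] ?];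
  rewrite /P3adj /P3vec /P3sgn /=; field: q_sqr; rewrite ?two_neq0 ?q_neq0 //.
Qed.

Variable n : nat.
Implicit Types (l x y : vert n) (Om : {set Z2vec n}) (b : Z2vec n).

Definition neps_vec l x : F := \prod_i P3vec (l i) (x i).

Definition sgn_prod l b : int := \prod_i (if b ord0 i == 0 then 1 else P3sgn (l i)).

Definition neps_eig Om l : F :=
  \sum_(b in Om) q ^+ hweight b * (sgn_prod l b)%:~R.

Lemma neps_vec_complete x y :
  \sum_l neps_vec l x * neps_vec l y = (x == y)%:R.
Proof.
under eq_bigr => l _ do rewrite /neps_vec -big_split /=.
rewrite -(bigA_distr_bigA (fun i k => P3vec k (x i) * P3vec k (y i))) /=.
under eq_bigr => i _ do rewrite P3vec_complete.
have [->|/eqP neq_xy] := eqVneq x y.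
  by rewrite big1 // => i _; rewrite eqxx.
have /existsP[i xyi] : [exists i, x i != y i].
  have [//|/existsPn eq_xy] := boolP [exists i, x i != y i]; case: neq_xy.
  by apply/ffunP => i; apply/eqP; move: (eq_xy i); rewrite negbK.
by rewrite (bigD1 i) //= (negbTE xyi) mul0r.
Qed.

Lemma F2_neq0 (a : 'F_2) : (a != 0) = (a == 1).
Proof. by case: a => [[|[|//]] ?]. Qed.

(** P_3 has no loops, so the coordinates where [x] and [y] differ determine [b]. At most one summand
    is nonzero, and the sum agrees with the existential. *)
Lemma neps_adjE Om x y :
  (neps_adj Om x y)%:R =
  \sum_(b in Om) \prod_i (if b ord0 i == 0 then x i == y i else P3adj (x i) (y i))%:R
  :> F.
Proof.
pose step b := [forall i, if b ord0 i == 0 then x i == y i else P3adj (x i) (y i)].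
have prodE b : \prod_i (if b ord0 i == 0 then x i == y i
    else P3adj (x i) (y i))%:R = (step b)%:R :> F.
  have [/forallP sb|] := boolP (step b).
    by rewrite big1 // => i _; rewrite sb.
  by move=> /forallPn[i /negbTE bi]; rewrite (bigD1 i) //= bi mul0r.
have step_inj b c : step b -> step c -> b = c.
  move=> /forallP sb /forallP sc; apply/rowP => i.
  have P3irr (a : 'I_3) : P3adj a a = false by case: a => [[|[|[|//]]] ?].
  move: (sb i) (sc i); have [b0|] := eqVneq (b ord0 i) 0.
    by move=> /eqP ->; rewrite P3irr; case: eqP => // ->.
  rewrite F2_neq0 => /eqP->; have [_ + /eqP e|] := eqVneq (c ord0 i) 0.
    by rewrite e P3irr.
  by rewrite F2_neq0 => /eqP->.
rewrite (eq_bigr _ (fun b _ => prodE b)) /neps_adj.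
have [/existsP[b /andP[bOm sb]]|] := boolP [exists b in Om, step b].
  rewrite (bigD1 b) //= sb big1 ?addr0 // => c /andP[_ /eqP neq].
  by case: (boolP (step c)) => // sc; case: neq; apply: step_inj.
move=> /existsPn ns; rewrite big1 // => b bOm.
by move: (ns b); rewrite bOm /= => /negbTE ->.
Qed.

Lemma neps_eigE Om l :
  neps_eig Om l =
  \sum_(b in Om) \prod_i (if b ord0 i == 0 then 1 else q * (P3sgn (l i))%:~R).
Proof.
apply: eq_bigr => b _.
rewrite /sgn_prod rmorph_prod /hweight -sum1_card.
rewrite (big_morph _ (exprD q) (expr0 q)) big_mkcond -big_split /=.
by apply: eq_bigr => i _; rewrite inE; case: eqP; rewrite ?mulr1 ?expr1.
Qed.

Lemma neps_vec_eigen Om l x :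
  \sum_y (neps_adj Om x y)%:R * neps_vec l y = neps_eig Om l * neps_vec l x.
Proof.
under eq_bigr => y _ do rewrite neps_adjE mulr_suml.
rewrite exchange_big /= neps_eigE mulr_suml; apply: eq_bigr => b _.
under eq_bigr => y _ do rewrite /neps_vec -big_split /=.
rewrite -(bigA_distr_bigA (fun i k => (if b ord0 i == 0 then x i == k
  else P3adj (x i) k)%:R * P3vec (l i) k)) /= /neps_vec -big_split /=.
apply: eq_bigr => i _; case: eqP => _; last exact: P3vec_eigen.
rewrite (bigD1 (x i)) //= eqxx big1 ?addr0 // => k.
by rewrite eq_sym => /negbTE->; rewrite mul0r.
Qed.

(** Completeness of the eigenvectors settles [m = 0]; each further power of the matrix contributes
    one eigenvalue. *)
Lemma adj_pow_spectral Om m x y :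
  (adj_pow Om m x y)%:R =
  \sum_l neps_eig Om l ^+ m * (neps_vec l x * neps_vec l y) :> F.
Proof.
elim: m x => [|m IH] x /=.
  by under eq_bigr => l _ do rewrite mul1r; rewrite neps_vec_complete.
rewrite natr_sum; under eq_bigr => w _ do rewrite natrM IH mulr_sumr.
rewrite exchange_big /=; apply: eq_bigr => l _.
rewrite exprSr -mulrA [neps_eig _ _ * _]mulrA -neps_vec_eigen mulr_suml mulr_sumr.
by apply: eq_bigr => w _; ring.
Qed.

End Spectral.

(** * Power series of exp(-ix), split into real and imaginary parts *)

Lemma negi_add2 (m : nat) :
  re_negi m.+2 = - re_negi m /\ im_negi m.+2 = - im_negi m.
Proof.
rewrite /re_negi /im_negi -addn2 -modnDml.
have : (m %% 4 < 4)%N by rewrite ltn_mod.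
by case: (m %% 4)%N => [|[|[|[|//]]]] _ /=; rewrite ?oppr0 ?opprK.
Qed.

Lemma negi_even (k : nat) :
  re_negi (2 * k) = (-1) ^+ k /\ im_negi (2 * k) = 0.
Proof.
elim: k => [|k [IHre IHim]]; first by rewrite /re_negi /im_negi /=.
have [re2 im2] := negi_add2 (2 * k).
by rewrite mulnS add2n re2 im2 IHre IHim exprS mulN1r oppr0.
Qed.

Lemma negi_odd (k : nat) :
  re_negi (2 * k).+1 = 0 /\ im_negi (2 * k).+1 = - (-1) ^+ k.
Proof.
elim: k => [|k [IHre IHim]]; first by rewrite /re_negi /im_negi /=.
have [re2 im2] := negi_add2 (2 * k).+1.
by rewrite mulnS add2n re2 im2 IHre IHim exprS mulN1r oppr0.
Qed.

(** [cos] is defined by a power series in the square of [x]; its partial sums are those of even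
    index here, as the odd terms vanish. *)
Lemma cos_series (x : R) :
  infinite_sum (fun m => re_negi m * (x ^+ m / m`!%:R)) (cos x).
Proof.
rewrite /cos; case: exist_cos => a cos_a eps /cos_a[N cvgN].
set f := fun m : nat => _ * (_ / _).
have f_even k : f (2 * k)%N = Rmult (cos_n k) (pow (Rsqr x) k).
  rewrite /f (negi_even k).1 /cos_n -[(_ * _)%coq_nat]/(2 * k)%N !RealsE.
  by rewrite /Rsqr exprM; ring.
have f_odd k : f (2 * k).+1 = 0 by rewrite /f (negi_odd k).1 mul0r.
have sum_even k : sum_f_R0 f (2 * k) =
    sum_f_R0 (fun i => Rmult (cos_n i) (pow (Rsqr x) i)) k.
  elim: k => [|k IH]; first by rewrite muln0 /= -(f_even 0%N).
  by rewrite mulnS add2n !tech5 IH f_odd -f_even mulnS add2n !RplusE addr0.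
exists (2 * N)%N => n /ssrnat.leP le_n; have le_n2 : (N <= n./2)%N by lia.
suff -> : sum_f_R0 f n = sum_f_R0 (fun i => Rmult (cos_n i) (pow (Rsqr x) i)) n./2.
  exact/cvgN/ssrnat.leP.
rewrite -sum_even -{1}(odd_double_half n) -muln2 mulnC.
by case: odd => //; rewrite add1n tech5 f_odd RplusE addr0.
Qed.

(** Now the even terms vanish, and [sin] is [x] times a series in the square of [x]. The minus sign
    is that of exp(-ix) = cos x - i sin x. *)
Lemma sin_series (x : R) :
  infinite_sum (fun m => im_negi m * (x ^+ m / m`!%:R)) (- sin x).
Proof.
rewrite /sin; case: exist_sin => a sin_a.
have xa : - Rmult x a = - x * a by rewrite RmultE mulNr.
have cvg_a : Un_cv (fun n => - x * sum_f_R0 (fun i => Rmult (sin_n i) (pow (Rsqr x) i)) n)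
                   (- Rmult x a).
  rewrite xa; apply: CV_mult => // eps eps0.
  by exists 0%N => n _; rewrite /Rdist Rminus_diag Rabs_R0.
move=> eps /cvg_a[N cvgN].
set f := fun m : nat => _ * (_ / _).
have f_odd k : f (2 * k).+1 = - x * Rmult (sin_n k) (pow (Rsqr x) k).
  rewrite /f (negi_odd k).2 /sin_n -[((_ * _)%coq_nat + 1)%coq_nat]/(2 * k + 1)%N addn1.
  by rewrite !RealsE /Rsqr exprS exprM RmultE; ring.
have f_even k : f (2 * k)%N = 0 by rewrite /f (negi_even k).2 mul0r.
have sum_odd k : sum_f_R0 f (2 * k).+1 =
    (- x * sum_f_R0 (fun i => Rmult (sin_n i) (pow (Rsqr x) i)) k)%R.
  elim: k => [|k IH]; first by rewrite tech5 muln0 /= (f_even 0%N) (f_odd 0%N) RplusE add0r.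
  rewrite mulnS add2n [LHS]tech5 [X in Rplus X _]tech5 IH.
  rewrite -[(2 * k).+3]/(2 + 2 * k).+1 -mulnS.
  by rewrite f_odd -[(2 * k).+2]/(2 + 2 * k)%N -mulnS f_even /= !RealsE; ring.
exists (2 * N).+2 => n /ssrnat.leP le_n; have le_n2 : (N <= n.-1./2)%N by lia.
suff -> : sum_f_R0 f n =
    (- x * sum_f_R0 (fun i => Rmult (sin_n i) (pow (Rsqr x) i)) n.-1./2)%R.
  exact/cvgN/ssrnat.leP.
rewrite -sum_odd; case: n le_n {le_n2} => // n le_n; rewrite -[n.+1.-1]/n.
rewrite -{1}(odd_double_half n) -muln2 mulnC; case: odd => //.
by rewrite add1n [LHS]tech5 -[(2 * n./2).+2]/(2 + 2 * n./2)%N -mulnS f_even RplusE addr0.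
Qed.

Lemma infinite_sum_lincomb (I : finType) (c : I -> R) (f : I -> nat -> R)
    (g : I -> R) (h : nat -> R) :
  (forall m, h m = \sum_i c i * f i m) ->
  (forall i, infinite_sum (f i) (g i)) -> infinite_sum h (\sum_i c i * g i).
Proof.
move=> hE cvg_f; suff : Un_cv (fun n => \sum_i c i * sum_f_R0 (f i) n) (\sum_i c i * g i).
  apply: Un_cv_ext => n; rewrite sum_f_R0E (eq_bigr _ (fun m _ => hE m)) exchange_big /=.
  by apply: eq_bigr => i _; rewrite sum_f_R0E mulr_sumr.
have cvg_cst (a : R) : Un_cv (fun=> a) a.
  by move=> eps eps0; exists 0%N => n _; rewrite /Rdist Rminus_diag Rabs_R0.
elim: (index_enum I) => [|i s IH].
  by rewrite big_nil; apply: Un_cv_ext (cvg_cst 0) => n; rewrite big_nil.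
rewrite big_cons;
  apply: Un_cv_ext (CV_plus _ _ _ _ (CV_mult _ _ _ _ (cvg_cst (c i)) (cvg_f i)) IH).
by move=> n; rewrite big_cons.
Qed.

(** * Elementary estimates and shifts for sine and cosine *)

Lemma norm_sin_le (x : R) : `|sin x| <= `|x|.
Proof.
have pos (y : R) : 0 < y -> `|sin y| <= y.
  move=> y0; rewrite ler_norml; apply/andP; split; last exact/ltW/RltP/sin_lt_x/RltP.
  have sin_ge : - 1 <= sin y by apply/RleP/(proj1 (SIN_bound y)).
  have [y1|y1] := lerP y 1; last by lra.
  suff : 0 <= sin y by lra.
  apply/RleP/sin_ge_0; apply/RleP; first exact: ltW.
  by move/RltP: PI2_1; rewrite !RealsE /=; lra.
have [x0|x0|->] := ltrgtP x 0; last by rewrite sin_0.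
- by rewrite -normrN -RoppE -sin_neg [leRHS]ltr0_norm ?pos ?oppr_gt0.
- by rewrite [leRHS]gtr0_norm ?pos.
Qed.

Lemma norm_cos_sub1_le (x : R) : `|cos x - 1| <= `|x|.
Proof.
have -> : cos x - 1 = - 2 * (sin (x / 2) * sin (x / 2)).
  have {1}-> : x = Rmult (IZR 2) (x / 2) by rewrite !RealsE /=; field.
  by rewrite cos_2a_sin !RealsE /=; ring.
have s1 := norm_sin_le (x / 2); have s2 : `|sin (x / 2)| <= 1.
  by rewrite ler_norml; apply/andP; split; apply/RleP; have [? ?] := SIN_bound (x / 2).
have s0 := normr_ge0 (sin (x / 2)).
rewrite !normrM normrN normr_nat in s1 *; rewrite [`|2^-1|]gtr0_norm // in s1; nra.
Qed.

Lemma cos_sin_shift (k : int) (x : R) :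
  cos (k%:~R * PI + x) = (-1) ^ k * cos x /\ sin (k%:~R * PI + x) = (-1) ^ k * sin x.
Proof.
have nat_shift (m : nat) (y : R) : cos (m%:R * PI + y) = (-1) ^+ m * cos y /\
    sin (m%:R * PI + y) = (-1) ^+ m * sin y.
  elim: m => [|m [IHc IHs]]; first by rewrite mul0r add0r !mul1r.
  have -> : m.+1%:R * PI + y = Rplus (m%:R * PI + y) PI
    by rewrite RplusE -natr1 mulrDl mul1r addrAC.
  by rewrite neg_cos neg_sin IHc IHs exprS !RealsE; split; ring.
case: k => m; first exact: nat_shift.
rewrite NegzE expN1r abszN absz_nat.
have [] := nat_shift m.+1 ((- m.+1%:Z)%:~R * PI + x).
have -> : m.+1%:R * PI + ((- m.+1%:Z)%:~R * PI + x) = x by rewrite rmorphN /=; ring.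
by move=> -> ->; rewrite !mulrA -exprMn mulrNN mulr1 expr1n !mul1r.
Qed.

(** * Approximations from powers of the unit 3 - 2 sqrt 2 *)

Lemma sqrt2_sqr : sqrt 2 * sqrt 2 = 2 :> R.
Proof. by rewrite RsqrtE -expr2 sqr_sqrtr ?ler0n. Qed.

Lemma sqrt2_neq0 : sqrt 2 != 0 :> R.
Proof. by apply: contraTneq isT => q0; have := sqrt2_sqr; rewrite q0; lra. Qed.

(* (P - B sqrt 2)^2 = (P^2 + 2 B^2) - 2 P B sqrt 2, so each squaring of
   3 - 2 sqrt 2 gains a factor 2 in the coefficient of sqrt 2. *)
Lemma pell_sqrt2 (m : nat) (eps : R) : 0 < eps ->
  exists P Q : nat, odd P /\ `|P%:R - 2 ^+ m.+1 * Q%:R * sqrt 2| < eps.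
Proof.
move=> eps0; have q2 := sqrt2_sqr; have q0 : 0 <= sqrt 2 by apply/RleP/sqrt_pos.
have iter j : exists P Q : nat, odd P /\
    0 <= P%:R - 2 ^+ j.+1 * Q%:R * sqrt 2 <= 2 ^- j.+1.
  elim: j => [|j [P [Q [oddP /andP[ge0 le1]]]]].
    by exists 3, 1%N; split=> //; rewrite !expr1; apply/andP; split; nra.
  exists (P ^ 2 + 2 * (2 ^ j.+1 * Q) ^ 2)%N, (P * Q)%N; split.
    by rewrite oddD oddX oddP oddM.
  set e := _ - _ in ge0 le1.
  have -> : (P ^ 2 + 2 * (2 ^ j.+1 * Q) ^ 2)%:R - 2 ^+ j.+2 * (P * Q)%:R * sqrt 2 = e * e.
    rewrite /e natrD natrM !natrX !natrM natrX [2 ^+ j.+2]exprS.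
    by ring: q2.
  rewrite mulr_ge0 //= exprSr invfM ler_pM // (le_trans le1) // lef_pV2 ?posrE ?exprn_gt0 //.
  by rewrite exprS ler_pMr // exprn_ege1 // ler1n.
(* Enough squarings for both the precision and the power of 2; the surplus factor [2 ^ (j - m)] is
   absorbed into [Q]. *)
have [j [le_mj lt_eps]] : exists j, (m <= j)%N /\ 2 ^- j.+1 < eps.
  pose N := Num.truncn eps^-1; exists (maxn m N); split; first exact: leq_maxl.
  rewrite -[eps]invrK ltf_pV2 ?posrE ?exprn_gt0 ?invr_gt0 //.
  apply: (lt_le_trans (truncnS_gt _)); rewrite -natrX ler_nat.
  by apply: (leq_trans _ (ltnW (ltn_expl _ (ltnSn 1)))); rewrite ltnS leq_maxr.
have [P [Q [oddP /andP[ge0 le]]]] := iter j.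
exists P, (2 ^ (j - m) * Q)%N; split=> //.
rewrite natrM natrX mulrA -exprD addSn subnKC // ger0_norm //.
exact: le_lt_trans lt_eps.
Qed.

(** * Phases of the eigenvalues and their parity *)

Section Phase.

Variable n : nat.
Implicit Types (l : vert n) (Om : {set Z2vec n}) (b : Z2vec n).

Definition min_phase Om (m : nat) l : int :=
  \sum_(b in Om | odd (hweight b) == odd m)
     sgn_prod l b * 2 ^+ (hweight b - m)./2.

(** A tuple [b] contributes [q] to the power [m + 1 + hweight b]. If the parities of [hweight b] and
    [m] agree, this is [q] times a power of 2 divisible by [2 ^+ m], because [m <= hweight b];
    otherwise it is an integer. *)
Lemma neps_eig_phase (F : fieldType) (q : F) (q_sqr : q * q = 2) Om (m : nat) l :
  (forall b, b \in Om -> odd (hweight b) = odd m -> (m <= hweight b)%N) ->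
  exists N : int, q ^+ m.+1 * neps_eig q Om l =
    2 ^+ m * q * (min_phase Om m l)%:~R + N%:~R.
Proof.
move=> m_min; have q_even k : q ^+ k.*2 = 2 ^+ k by rewrite -muln2 mulnC exprM expr2 q_sqr.
exists (\sum_(b in Om | odd (hweight b) != odd m)
  sgn_prod l b * 2 ^+ (m.+1 + hweight b)./2).
rewrite /neps_eig mulr_sumr (bigID (fun b => odd (hweight b) == odd m)) /=; congr (_ + _).
  rewrite rmorph_sum mulr_sumr; apply: eq_bigr => b /andP[bOm /eqP eq_odd].
  have le_m := m_min b bOm eq_odd.
  rewrite rmorphM rmorphXn /= mulrA -exprD.
  have -> : (m.+1 + hweight b = (m + (hweight b - m)./2).*2.+1)%N.
    have : odd (hweight b - m) = false by rewrite oddB // eq_odd addbb.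
    by lia.
  by rewrite exprS q_even exprD; ring.
rewrite rmorph_sum; apply: eq_bigr => b /andP[bOm neq_odd].
rewrite rmorphM rmorphXn /= rmorph_nat mulrA -exprD mulrC; congr (_ * _).
rewrite -q_even -[uphalf _]/(m.+1 + hweight b)./2 even_halfK // oddD /=.
by move: neq_odd; case: odd; case: odd.
Qed.

Lemma signr_int_sum (F : fieldType) (I : finType) (P : pred I) (c : I -> int) :
  (-1 : F) ^ (\sum_(i | P i) c i) = \prod_(i | P i) (-1) ^ (c i).
Proof.
have N1 : (-1 : F) != 0 by rewrite oppr_eq0 oner_eq0.
by apply: (big_morph (fun c : int => (-1 : F) ^ c)) => // x y; rewrite expfzDr.
Qed.

(** The product is 0 if [j] is in the support of [b] with sign 0, and is 1 or -1 otherwise. *)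
Lemma sgn_prod_parity (F : numFieldType) l b (j : 'I_n) :
  (forall i, i != j -> P3sgn (l i) != 0) ->
  (-1 : F) ^ sgn_prod l b = if (b ord0 j != 0) && (P3sgn (l j) == 0) then 1 else -1.
Proof.
move=> l_neq0; case: ifPn => [/andP[bj /eqP lj]|].
  by rewrite /sgn_prod (bigD1 j) //= (negbTE bj) lj mul0r.
move=> bj; rewrite expN1r.
suff -> : `|sgn_prod l b|%N = 1%N by rewrite expr1.
have P3sgn1 (k : 'I_3) : P3sgn k != 0 -> `|P3sgn k|%N = 1%N.
  by case: k => [[|[|[|//]]] ?].
rewrite /sgn_prod (big_morph absz abszM absz1) big1 // => i _.
case: ifPn => // bi; apply: P3sgn1; have [eq_ij|/l_neq0 //] := eqVneq i j.
by move: bj; rewrite eq_ij in bi *; rewrite bi.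
Qed.

(* Only the weight m terms of min_phase can be odd. *)
Lemma min_phase_parity (F : numFieldType) Om (m : nat) l (j : 'I_n) :
  (forall b, b \in Om -> odd (hweight b) = odd m -> (m <= hweight b)%N) ->
  (\sum_(b in Om | hweight b == m) b) ord0 j != 0 ->
  (forall i, i != j -> P3sgn (l i) != 0) ->
  (-1 : F) ^ min_phase Om m l =
    (if P3sgn (l j) == 0 then -1 else 1) *
    (-1) ^+ #|[set b in Om | hweight b == m]|.
Proof.
move=> m_min sum_j l_neq0; rewrite /min_phase signr_int_sum.
rewrite (bigID (fun b => hweight b == m)) /= [X in _ * X]big1 ?mulr1; last first.
  move=> b /andP[/andP[bOm /eqP eq_odd] neq_m]; have le_m := m_min b bOm eq_odd.
  have : (0 < (hweight b - m)./2)%N.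
    have : odd (hweight b - m) = false by rewrite oddB // eq_odd addbb.
    by lia.
  case: (_./2) => // k _; rewrite expN1r abszM abszX -signr_odd.
  by rewrite oddM oddX andbF.
rewrite (eq_bigl (fun b => (b \in Om) && (hweight b == m))); last first.
  by move=> b; case: (b \in Om) => //=; case: (hweight b =P m) => [->|_]; rewrite ?eqxx ?andbF.
(* Each tuple gives -1, corrected by another -1 when the zero sign at [j] kills its product. *)
rewrite (eq_bigr (fun b => (-1) * (-1) ^+ ((b ord0 j != 0) && (P3sgn (l j) == 0)))); last first.
  move=> b /andP[_ /eqP->]; rewrite subnn mulr1 (sgn_prod_parity _ _ l_neq0).
  by case: (_ && _); rewrite ?mulrNN mulr1.
rewrite big_split /= mulrC; congr (_ * _); last first.
  by rewrite prodr_const; congr (_ ^+ _); apply: eq_card => b; rewrite !inE.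
have [lj|_] := eqVneq (P3sgn (l j)) 0; last by rewrite big1 // => b _; rewrite andbF.
have F2E (a : 'F_2) : a = (a != 0)%:R by case: a => [[|[|//]] ?]; apply: val_inj.
move: sum_j; rewrite summxE (eq_bigr _ (fun b _ => F2E _)) -natr_sum.
rewrite (eq_bigr (fun b => (-1 : F) ^+ (b ord0 j != 0))) => [|b _]; last by rewrite andbT.
rewrite -(big_morph _ (exprD (-1)) (expr0 (-1))).
(* [N] counts the weight [m] tuples with [j] in their support; mod 2 it is the coordinate assumed
   nonzero. *)
set N := (\sum_(_ | _) _)%N => N_neq0; rewrite -signr_odd.
suff -> : odd N by [].
apply/negPn/negP => even_N; move: N_neq0; rewrite -(even_halfK even_N) -muln2 natrM.
by rewrite (_ : 2%:R = 0) ?mulr0 ?eqxx //; apply: val_inj.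
Qed.

End Phase.

(** * Transfer between the two end vertices in one coordinate *)

Section Transfer.

Variable n : nat.
Implicit Types (l x y : vert n) (Om : {set Z2vec n}) (b : Z2vec n).

Lemma transition_series Om (t : R) x y :
  let c l := neps_vec (sqrt 2) l x * neps_vec (sqrt 2) l y in
  infinite_sum (H_term_re Om t x y)
    (\sum_l c l * cos (t * neps_eig (sqrt 2) Om l)) /\
  infinite_sum (H_term_im Om t x y)
    (\sum_l c l * - sin (t * neps_eig (sqrt 2) Om l)).
Proof.
move=> c.
split; [apply: infinite_sum_lincomb (fun l => cos_series _) => m
       | apply: infinite_sum_lincomb (fun l => sin_series _) => m];
  rewrite /H_term_re /H_term_im !(RmultE, RdivE, RpowE, INRE, factE)
    (adj_pow_spectral sqrt2_sqr sqrt2_neq0) mulr_sumr;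
  by apply: eq_bigr => l _; rewrite exprMn /c; ring.
Qed.

Definition spike (j : 'I_n) (k : 'I_3) : vert n := [ffun i => if i == j then k else 1].

(** The eigenvector of P_3 with sign 0 vanishes at the middle vertex. *)
Lemma spike_vec_support (q : R) (j : 'I_n) l :
  neps_vec q l (spike j ord0) != 0 -> forall i, i != j -> P3sgn (l i) != 0.
Proof.
move=> vec0 i neq_ij; apply: contraNneq vec0.
rewrite /neps_vec (bigD1 i) //= ffunE (negbTE neq_ij).
by rewrite /P3vec /P3sgn; case: (l i) => [[|[|[|//]]] ?] //=; rewrite mul0r.
Qed.

(** Reflecting P_3 negates its sign 0 eigenvector and fixes the other two. *)
Lemma spike_vec_opposite (q : R) (j : 'I_n) l :
  neps_vec q l (spike j ord_max) =
  (if P3sgn (l j) == 0 then -1 else 1) * neps_vec q l (spike j ord0).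
Proof.
rewrite /neps_vec !(bigD1 j (P := xpredT)) //= !ffunE eqxx mulrA; congr (_ * _).
  by rewrite /P3vec /P3sgn; case: (l j) => [[|[|[|//]]] ?] //=; rewrite ?mulN1r ?mul1r.
by apply: eq_bigr => i /negbTE neq_ij; rewrite !ffunE neq_ij.
Qed.

(** The modulus lies between [|a|] and [|a| + |b|], and [|a|] is within [d] of 1. *)
Lemma dist_modulus1_lt (a b k d eps : R) :
  `|k| = 1 -> `|a - k| <= d -> `|b| <= d -> 2 * d < eps ->
  Rlt (Rabs (Rminus (sqrt (Rplus (Rmult a a) (Rmult b b))) (IZR 1))) eps.
Proof.
move=> k1 a_near b_small d_small; apply/RltP; rewrite !RealsE -RsqrtE.
set s := sqrt _; have s0 : 0 <= s by apply/RleP/sqrt_pos.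
have ss : s * s = `|a| * `|a| + `|b| * `|b|.
  rewrite /s RsqrtE -expr2 sqr_sqrtr ?addr_ge0 -?expr2 ?sqr_ge0 //.
  by rewrite !real_normK ?num_real.
have := ler_dist_dist a k; rewrite k1 => /le_trans/(_ a_near).
rewrite ler_norml => /andP[a1 a2].
have a0 := normr_ge0 a; have b0 := normr_ge0 b.
have lo : `|a| <= s by rewrite leNgt; apply/negP => lt_s; nra.
have hi : s <= `|a| + `|b| by rewrite leNgt; apply/negP => lt_s; nra.
by rewrite ltr_norml; apply/andP; split; lra.
Qed.

Lemma spike_PGST Om (m : nat) (j : 'I_n) :
  (forall b, b \in Om -> odd (hweight b) = odd m -> (m <= hweight b)%N) ->
  (\sum_(b in Om | hweight b == m) b) ord0 j != 0 ->
  PGST Om (spike j ord0) (spike j ord_max).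
Proof.
move=> m_min sum_j eps /RltP; rewrite R0E => eps0.
set u := spike j ord0; set v := spike j ord_max.
pose q : R := sqrt 2; pose p l := neps_vec q l u ^+ 2.
have p_ge0 l : 0 <= p l by exact: sqr_ge0.
have p_sum : \sum_l p l = 1.
  by rewrite (neps_vec_complete sqrt2_sqr sqrt2_neq0 u u : \sum_l p l = _) eqxx.
have PI_ge0 : 0 <= PI by apply/RleP/Rlt_le/PI_RGT_0.
(* [K] times the approximation error bounds the weighted mean of the phase errors. The tolerance
   below divides by [K + 1], as [K] may be 0. *)
pose K := \sum_l p l * (PI * `|(min_phase Om m l)%:~R|).
have K_ge0 : 0 <= K.
  by apply: sumr_ge0 => l _; exact: mulr_ge0 (p_ge0 l) (mulr_ge0 PI_ge0 (normr_ge0 _)).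
have eps1 : 0 < eps / (2 * (K + 1)).
  by rewrite divr_gt0 // mulr_gt0 // ltr_wpDl.
have [P [Q [oddP]]] := pell_sqrt2 m eps1; set e := _ - _ => e_small.
pose t := 2 * PI * Q%:R * q ^+ m.+1.
pose k := @GRing.exp R (-1) #|[set b in Om | hweight b == m]|.
pose x l := - (PI * (min_phase Om m l)%:~R * e).
(* Replacing [2 ^+ m.+1 * Q * q] by [P - e] splits off the error [x l]; [P] odd gives [s] the parity
   of [min_phase]. *)
have phase l : exists2 s : int, t * neps_eig q Om l = s%:~R * PI + x l &
    (-1) ^ s = (-1) ^ min_phase Om m l :> R.
  have [N eigE] := neps_eig_phase sqrt2_sqr l m_min.
  exists (P%:Z * min_phase Om m l + 2 * (Q%:Z * N)).
    rewrite /t -mulrA eigE /x /e rmorphD !rmorphM rmorph_nat /= -!pmulrn exprS.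
    by rewrite /q; ring.
  have N1 : -1 != 0 :> R by rewrite oppr_eq0 oner_eq0.
  have P1 : (-1) ^ P%:Z = -1 :> R by rewrite -exprnP -signr_odd oddP expr1.
  have two1 : (-1) ^ (2 : int) = 1 :> R by rewrite expN1r sqrrN expr1n.
  by rewrite expfzDr // -!exprz_exp P1 two1 !exp1rz mulr1.
(* The sign relating [u] and [v] cancels the one in the phase, leaving a sign [k] common to all
   [l]. *)
have amp l : neps_vec q l u * neps_vec q l v * cos (t * neps_eig q Om l) =
      p l * (k * cos (x l)) /\
    neps_vec q l u * neps_vec q l v * - sin (t * neps_eig q Om l) =
      p l * (k * - sin (x l)).
  rewrite /v spike_vec_opposite -/u /p.
  have [->|vec0] := eqVneq (neps_vec q l u) 0; first by rewrite !(mul0r, expr0n).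
  have [s -> s_par] := phase l; have [-> ->] := cos_sin_shift s (x l).
  rewrite s_par (min_phase_parity R m_min sum_j (spike_vec_support vec0)) -/k.
  by case: ifP => _; split; ring.
have [] := transition_series Om t u v; rewrite -/q.
rewrite (eq_bigr _ (fun l _ => (amp l).1)) (eq_bigr _ (fun l _ => (amp l).2)).
move=> cvg_re cvg_im.
exists t; eexists; eexists; split; [exact: cvg_re|split; first exact: cvg_im].
have k1 : `|k| = 1 by rewrite normrX normrN1 expr1n.
have x_le l : `|x l| = PI * `|(min_phase Om m l)%:~R| * `|e|.
  by rewrite /x normrN 2!normrM (ger0_norm PI_ge0).
have K_e : K * `|e| = \sum_l p l * `|x l|.
  by rewrite /K mulr_suml; apply: eq_bigr => l _; rewrite x_le !mulrA.
pose d := K * `|e|; apply: (@dist_modulus1_lt _ _ k d) => //; rewrite /d.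
- have kE : k = \sum_l k * p l by rewrite -mulr_sumr p_sum mulr1.
  rewrite [X in _ - X]kE -sumrB K_e.
  apply: (le_trans (ler_norm_sum _ _ _)); apply: ler_sum => l _.
  have -> : p l * (k * cos (x l)) - k * p l = p l * (k * (cos (x l) - 1)) by ring.
  by rewrite (normrM (p l)) (normrM k) k1 mul1r (ger0_norm (p_ge0 l)) ler_wpM2l ?norm_cos_sub1_le.
- rewrite K_e; apply: (le_trans (ler_norm_sum _ _ _)); apply: ler_sum => l _.
  rewrite (normrM (p l)) (normrM k) k1 mul1r normrN (ger0_norm (p_ge0 l)).
  by rewrite ler_wpM2l ?norm_sin_le.
- move: e_small; rewrite ltr_pdivlMr; last by lra.
  by have := normr_ge0 e; nra.
Qed.

End Transfer.

(** * Choice of the weight and the coordinate from a parity class *)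

Lemma minimal_parity_sum_PGST (n : nat) (Om S : {set Z2vec n}) (o : bool) :
  S = [set b in Om | odd (hweight b) == o] ->
  \sum_(b in min_weight_part S) b != 0 -> exists u v : vert n, u <> v /\ PGST Om u v.
Proof.
move=> SE sum_neq0.
(* A nonzero sum is not empty; the weight of any member serves as [m]. *)
have [b0 b0min] : exists b0, b0 \in min_weight_part S.
  apply/set0Pn; apply: contraNneq sum_neq0 => ->; by rewrite big_set0.
have := b0min; rewrite inE SE inE => /andP[/andP[b0Om /eqP b0o] /forallP b0le].
have m_min b : b \in Om -> odd (hweight b) = odd (hweight b0) ->
    (hweight b0 <= hweight b)%N.
  by move=> bOm bo; have := b0le b; rewrite inE bOm bo b0o eqxx.
have sumE : \sum_(b in min_weight_part S) b =
    \sum_(b in Om | hweight b == hweight b0) b.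
  apply: eq_bigl => b; rewrite inE SE inE; apply/idP/idP.
    move=> /andP[/andP[bOm /eqP bo] /forallP /(_ b0)]; rewrite inE b0Om b0o eqxx /= => le_b.
    by rewrite bOm eqn_leq le_b m_min // bo b0o.
  move=> /andP[bOm /eqP eq_b]; rewrite bOm eq_b b0o eqxx /=.
  by apply/forallP => c; rewrite b0le.
have [j sum_j] : exists j, (\sum_(b in Om | hweight b == hweight b0) b) ord0 j != 0.
  by rewrite sumE in sum_neq0; move/rV0Pn: sum_neq0.
exists (spike j ord0), (spike j ord_max); split; last exact: spike_PGST sum_j.
by move/ffunP/(_ j); rewrite !ffunE eqxx.
Qed.

Theorem theorem3p9 (n : nat) (Om : {set Z2vec n}) :
  (0%R : Z2vec n) \notin Om ->
  Omega_e Om != set0 ->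
  Omega_o Om != set0 ->
  rankZ2 Om = n ->
  ((\sum_(b in min_weight_part (Omega_o Om)) b)%R != 0%R \/
   (\sum_(b in min_weight_part (Omega_e Om)) b)%R != 0%R) ->
  exists u v : vert n, u <> v /\ PGST Om u v.
Proof.
move=> _ _ _ _ [sum_neq0|sum_neq0].
- apply: (minimal_parity_sum_PGST (o := true)) sum_neq0.
  by apply/setP => b; rewrite !inE eqb_id.
- apply: (minimal_parity_sum_PGST (o := false)) sum_neq0.
  by apply/setP => b; rewrite !inE eqbF_neg.
Qed.
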